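(* Let $n\ge 2$ be an integer, $\rho\in\mathbb{C}$, and let $K_n(\rho)=\left[\rho^{|j-k|}\right]_{j,k=1}^n$ (with the convention $\rho^0=1$, so $K_n(0)=I_n$). Then: (i) all entries of $K_n(\rho)$ are positive iff $\rho>0$; (ii) $K_n(\rho)$ is real symmetric iff $\rho\in\mathbb{R}$; (iii) $K_n(\rho)$ is Hermitian iff $\rho\in\mathbb{R}$; (iv) the symbol of the corresponding Laurent matrix, i.e. the Fourier series $\sum_{k=-\infty}^{\infty}\rho^{|k|}e^{ik\theta}$ ($\theta\in\mathbb{R}$), is a well-defined and bounded function of $\theta$ iff $|\rho|<1$; (v) $K_n(\rho)$ is positive definite iff $-1<\rho<1$, and $K_n(\rho)$ is positive semidefinite iff $-1\le\rho\le 1$; (vi) $K_n(\rho)$ is normal iff ($\rho\in\mathbb{R}$ or $n=2$); (vii) $K_n(\rho)$ is a Green's matrix iff $\rho\in\mathbb{R}\setminus\{0\}$; (viii) $K_n(\rho)$ is totally positive iff $0\le\rho\le 1$; (ix) $K_n(\rho)$ is oscillatory iff $0<\rho<1$.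
   Context: A complex $n\times n$ matrix $A$ is positive definite (positive semidefinite) if $x^*Ax>0$ ($x^*Ax\ge 0$) for all nonzero $x\in\mathbb{C}^n$. A real $n\times n$ matrix $A=[A_{jk}]$ is a Green's matrix if there exist real numbers $\alpha_1,\dots,\alpha_n,\beta_1,\dots,\beta_n$ with $A_{jk}=\alpha_j\beta_k$ for $1\le j\le k\le n$ and $A_{jk}=\alpha_k\beta_j$ for $1\le k\le j\le n$. A (real) matrix is totally positive if every minor is nonnegative. A totally positive square matrix is oscillatory if some positive integer power of it has all minors strictly positive. *)

(* Defs.v *)
From HB Require Import structures.
From mathcomp Require Import all_boot all_order all_algebra.
From mathcomp Require Import all_classical all_reals all_analysis.
From mathcomp Require Import complex.
Set Implicit Arguments. Unset Strict Implicit. Unset Printing Implicit Defensive.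
Import Order.TTheory GRing.Theory Num.Theory.
Import numFieldTopology.Exports numFieldNormedType.Exports.
Local Open Scope ring_scope.
Local Open Scope classical_set_scope.
Local Open Scope complex_scope.

Definition KMS (C : pzRingType) (n : nat) (rho : C) : 'M[C]_n :=
  \matrix_(j < n, k < n) rho ^+ `|j - k|%N.

Local Open Scope sesquilinear_scope.

Definition all_entries_pos (C : numDomainType) n (A : 'M[C]_n) : Prop :=
  forall j k, 0 < A j k.

Definition pos_def (C : numClosedFieldType) n (A : 'M[C]_n) : Prop :=
  forall x : 'cV[C]_n, x != 0 -> 0 < (x ^t* *m A *m x) 0 0.

Definition pos_semidef (C : numClosedFieldType) n (A : 'M[C]_n) : Prop :=
  forall x : 'cV[C]_n, 0 <= (x ^t* *m A *m x) 0 0.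

Definition greens_matrix (R : realType) n (A : 'M[R[i]]_n) : Prop :=
  exists alpha beta : 'I_n -> R,
    (forall j k : 'I_n, (j <= k)%N -> A j k = (alpha j * beta k)%:C) /\
    (forall j k : 'I_n, (k <= j)%N -> A j k = (alpha k * beta j)%:C).

Definition mx_minor (C : comPzRingType) n p (A : 'M[C]_n) (f g : 'I_p -> 'I_n) : C :=
  \det (mxsub f g A).

Definition strictly_incr n p (f : 'I_p -> 'I_n) : Prop :=
  forall a b : 'I_p, (a < b)%N -> (f a < f b)%N.

(* totally positive: every mx_minor is nonnegative (in particular real) *)
Definition totally_positive (C : numDomainType) n (A : 'M[C]_n) : Prop :=
  forall p (f g : 'I_p -> 'I_n), strictly_incr f -> strictly_incr g ->
    0 <= mx_minor A f g.

Definition strictly_totally_positive (C : numDomainType) n (A : 'M[C]_n) : Prop :=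
  forall p (f g : 'I_p -> 'I_n), strictly_incr f -> strictly_incr g ->
    0 < mx_minor A f g.

Definition oscillatory (C : numDomainType) n (A : 'M[C]_n) : Prop :=
  totally_positive A /\
  exists m : nat, (0 < m)%N /\ strictly_totally_positive (iter m (mulmx A) 1%:M).

Definition cexpi (R : realType) (t : R) : R[i] := cos t +i* sin t.

(* symmetric partial sum  sum_{k=-N}^{N} rho^|k| e^{i k theta} *)
Definition symbol_partial (R : realType) (rho : R[i]) (theta : R) (N : nat) : R[i] :=
  \sum_(0 <= i < (2 * N).+1)
     rho ^+ `|i - N|%N * cexpi ((i%:Z - N%:Z)%:~R * theta).

Definition symbol_well_defined_bounded (R : realType) (rho : R[i]) : Prop :=
  exists f : R -> R[i],
    (forall theta : R,
       (symbol_partial rho theta : nat -> (R[i] : numFieldType)) @ \oo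
         --> (f theta : (R[i] : numFieldType))) /\
    (exists M : R, forall theta : R, `|f theta| <= M%:C).

(* Main.v *)
Require Import Defs.
From HB Require Import structures.
From mathcomp Require Import all_boot all_order all_algebra.
From mathcomp Require Import all_classical all_reals all_analysis.
From mathcomp Require Import complex.
From mathcomp Require Import perm zify ring lra.
Set Implicit Arguments. Unset Strict Implicit. Unset Printing Implicit Defensive.
Import Order.TTheory GRing.Theory Num.Theory.
Import numFieldTopology.Exports numFieldNormedType.Exports.
Local Open Scope ring_scope.

(** For [0 < r <= 1], [r^|j-k| = r^j r^k min(r^(-2j), r^(-2k))], so every minor
    of the matrix is a positive multiple of the determinant of a kernel
    [min(x_a, y_b)] with nondecreasing [x] and [y]. Subtracting the first column
    (or row) from the others reduces such a determinant to a smaller one of the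
    same kind; it is nonnegative, and positive when [x] and [y] interlace. By the
    Cauchy-Binet formula, a minor of a power is then positive as soon as its two
    index sets are joined by a chain of interlacing index sets. Positive
    definiteness comes from completing the square along the recursion
    [s_k = rho s_(k-1) + x_k], which turns the quadratic form into
    [(1 - rho^2) (|s_0|^2 + ... + |s_(n-2)|^2) + |s_(n-1)|^2]. *)

(** * Symmetry, and determinants with a constant first row *)

Lemma KMS_tr (C : pzRingType) n (rho : C) : (KMS n rho)^T = KMS n rho.
Proof. by apply/matrixP => j k; rewrite !mxE distnC. Qed.

(** Right multiplication by the unipotent [U] subtracts the first column from all the others; this
    clears the first row beyond its corner and leaves a block lower triangular matrix. *)
Lemma det_row0_const (R : comPzRingType) p (A : 'M[R]_p.+1) :
  (forall b, A ord0 b = A ord0 ord0) ->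
  \det A = A ord0 ord0 *
    \det (\matrix_(a < p, b < p)
            (A (lift ord0 a) (lift ord0 b) - A (lift ord0 a) ord0)).
Proof.
move=> A0.
pose U : 'M[R]_(1 + p) := block_mx 1%:M (- const_mx 1) 0 1%:M.
have detU : \det U = 1 by rewrite det_ublock !det1 mulr1.
rewrite -[LHS]mulr1 -detU -det_mulmx.
have -> : A *m U = @block_mx _ 1 p 1 p (@ulsubmx _ 1 p 1 p A) (@ursubmx _ 1 p 1 p A)
   (@dlsubmx _ 1 p 1 p A) (@drsubmx _ 1 p 1 p A) *m U by rewrite submxK.
rewrite mulmx_block !mulmx1 !mulmx0 !addr0.
have -> : @ulsubmx _ 1 p 1 p A *m - const_mx 1 + @ursubmx _ 1 p 1 p A = 0.
  apply/matrixP => i j; rewrite !mxE big_ord1 !mxE !ord1 mulrN1.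
  rewrite lshift0 A0 [X in _ + X](_ : _ = A ord0 ord0) ?addNr //.
rewrite [LHS](@det_lblock _ 1 p) det_mx11 !mxE lshift0; congr (_ * \det _).
apply/matrixP => a b; rewrite !mxE big_ord1 !mxE mulrN1 addrC !lshift0.
by rewrite !rshift1.
Qed.

(** * Determinants of min kernels *)

Section MinKernel.
Variable R : realFieldType.

Definition min_kernel {p} (x y : 'I_p -> R) : 'M[R]_p :=
  \matrix_(a, b) Num.min (x a) (y b).

Lemma min_kernel_tr p (x y : 'I_p -> R) : (min_kernel x y)^T = min_kernel y x.
Proof. by apply/matrixP => a b; rewrite !mxE minC. Qed.

(** The first row is constantly [x ord0]. Subtracting the first column keeps the shape of the kernel
    because [min(u, v) - min(u, w) = min(max(u - w, 0), v - w)] whenever [w <= v]. *)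
Lemma det_min_kernel_rec p (x y : 'I_p.+1 -> R) :
  (forall b, x ord0 <= y b) -> (forall b, y ord0 <= y b) ->
  \det (min_kernel x y) = x ord0 *
    \det (min_kernel (fun a : 'I_p => Num.max (x (lift ord0 a) - y ord0) 0)
                     (fun b : 'I_p => y (lift ord0 b) - y ord0)).
Proof.
move=> xy yy; rewrite det_row0_const => [|b]; last first.
  by rewrite !mxE !min_l ?xy.
rewrite !mxE min_l ?xy //; congr (_ * \det _).
apply/matrixP => a b; rewrite !mxE.
have := yy (lift ord0 b); move: (x _) (y _) (y ord0) => u v w wv.
rewrite /Order.min /Order.max; repeat case: ifPn; lra.
Qed.

Lemma det_min_kernel_ge0 p (x y : 'I_p -> R) :
  (forall a b : 'I_p, (a <= b)%N -> x a <= x b) ->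
  (forall a b : 'I_p, (a <= b)%N -> y a <= y b) ->
  (forall a, 0 <= x a) -> (forall a, 0 <= y a) ->
  0 <= \det (min_kernel x y).
Proof.
elim: p x y => [|p IH] x y; first by rewrite det_mx00.
(* Transposition exchanges [x] and [y], so the smallest node may be assumed to be [x ord0], as the
   recursion requires. *)
wlog xy0 : x y / x ord0 <= y ord0 => [wl xx yy x0 y0|xx yy x0 y0].
  case: (leP (x ord0) (y ord0)) => [|/ltW] h; first exact: wl.
  by rewrite -det_tr min_kernel_tr; exact: wl.
rewrite det_min_kernel_rec => [|b|b]; last 2 first.
- by apply: le_trans xy0 _; exact: yy.
- exact: yy.
rewrite mulr_ge0 //; apply: IH => [a b ab|a b ab|a|a].
- have := xx (lift ord0 a) (lift ord0 b) ab.
  by rewrite ge_max !le_max lerD2r => ->; rewrite lexx orbT.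
- by rewrite lerD2r yy.
- by rewrite le_max lexx orbT.
- by rewrite subr_ge0 yy.
Qed.

(** Both nodes of index [a] lie below both nodes of any larger index. This makes the truncation at 0
    in the recursion inactive: the reduced nodes are plain differences, positive and again
    interlacing. *)
Lemma det_min_kernel_gt0 p (x y : 'I_p -> R) :
  (forall a b : 'I_p, (a < b)%N -> [/\ x a < x b, y a < y b, x a < y b & y a < x b]) ->
  (forall a, 0 < x a) -> (forall a, 0 < y a) ->
  0 < \det (min_kernel x y).
Proof.
elim: p x y => [|p IH] x y; first by rewrite det_mx00 ltr01.
wlog xy0 : x y / x ord0 <= y ord0 => [wl xy x0 y0|xy x0 y0].
  case: (leP (x ord0) (y ord0)) => [|/ltW] h; first exact: wl.
  by rewrite -det_tr min_kernel_tr; apply: wl => // a b /xy[].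
have yy b : y ord0 <= y b.
  by case: (unliftP ord0 b) => [c|] ->//; case: (xy ord0 (lift ord0 c)) => // _ /ltW.
rewrite det_min_kernel_rec // => [|b]; last exact: le_trans xy0 _.
have maxE a : Num.max (x (lift ord0 a) - y ord0) 0 = x (lift ord0 a) - y ord0.
  by case: (xy ord0 (lift ord0 a)) => // _ _ _ h; rewrite max_l // subr_ge0 ltW.
rewrite mulr_gt0 //; apply: IH => [a b ab|a|a]; rewrite ?maxE ?subr_gt0.
- by rewrite !ltrD2r; apply: xy.
- by case: (xy ord0 (lift ord0 a)).
- by case: (xy ord0 (lift ord0 a)).
Qed.

End MinKernel.

(** * Cauchy-Binet and products of totally positive matrices *)

Section CauchyBinet.

(* Summing over all index maps h instead of the increasing ones counts each
   nonzero term of the Cauchy-Binet formula p! times. *)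
Lemma Cauchy_Binet_sym (R : comPzRingType) p n (A : 'M[R]_(p, n)) (B : 'M[R]_(n, p)) :
  \sum_(h : {ffun 'I_p -> 'I_n}) \det (colsub h A) * \det (rowsub h B) =
  \det (A *m B) *+ p`!.
Proof.
have E : \det (A *m B) =
    \sum_(h : {ffun 'I_p -> 'I_n}) (\prod_a A a (h a)) * \det (rowsub h B).
  rewrite /determinant; under eq_bigr => s _ do
    (under eq_bigr => a _ do rewrite mxE; rewrite bigA_distr_bigA big_distrr).
  rewrite exchange_big; apply: eq_bigr => h _; rewrite big_distrr /=.
  apply: eq_bigr => s _; rewrite big_split /= mulrCA; congr (_ * (_ * _)).
  by apply: eq_bigr => a _; rewrite mxE.
transitivity (\sum_(s : 'S_p) \det (A *m B)); last first.
  by rewrite sumr_const card_Sn.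
under eq_bigr => h _ do rewrite {1}/determinant big_distrl.
rewrite exchange_big; apply: eq_bigr => s _ /=.
(* Precomposing [h] with the inverse of [s] permutes the rows of [rowsub h B]. The resulting sign
   cancels that of [s], so every [s] contributes the same sum. *)
rewrite E (reindex_inj (h := fun h : {ffun 'I_p -> 'I_n} => [ffun a => h ((s^-1)%g a)])).
  apply: eq_bigr => h _.
  have -> : rowsub [ffun a => h ((s^-1)%g a)] B = row_perm s^-1 (rowsub h B).
    by apply/matrixP => a b; rewrite !mxE ffunE.
  rewrite row_permE det_mulmx det_perm odd_permV.
  rewrite mulrACA -expr2 sqrr_sign mul1r; congr (_ * _).
  by apply: eq_bigr => a _; rewrite mxE ffunE permK.
move=> h1 h2 /ffunP h12; apply/ffunP => a.
by have := h12 (s a); rewrite !ffunE permK.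
Qed.

(** The rank of [a], the number of values of [h] below [h a], defines a permutation of the indices;
    its inverse sorts [h]. *)
Lemma injective_sortable p n (h : 'I_p -> 'I_n) :
  injective h -> exists s : 'S_p, strictly_incr (h \o s).
Proof.
move=> hI.
pose rank a := #|[set b | h b < h a]%N|.
have rank_lt a : (rank a < p)%N.
  rewrite -[X in (_ < X)%N]card_ord; apply: proper_card.
  by apply/properP; split; [exact/fintype.subsetP | exists a; rewrite // inE ltnn].
have rank_mono a b : (h a < h b)%N -> (rank a < rank b)%N.
  move=> hab; apply: proper_card; apply/properP; split.
    by apply/fintype.subsetP => c; rewrite !inE => /ltn_trans; apply.
  by exists a; rewrite !inE ?ltnn.
have rankI : injective (fun a => Ordinal (rank_lt a)).
  move=> a b [] rab; apply: hI; apply: val_inj => /=.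
  by case: (ltngtP (h a) (h b)) => // /rank_mono; rewrite rab ltnn.
exists (perm rankI)^-1%g => a b ab /=.
set t := (perm rankI)^-1%g.
have rk c : rank (t c) = c.
  have : perm rankI (t c) = c by rewrite permKV.
  by rewrite permE => /(congr1 val).
case: (ltngtP (h (t a)) (h (t b))) => //.
  by move=> /rank_mono; rewrite !rk => /(ltn_trans ab); rewrite ltnn.
by move=> /val_inj/hI/(congr1 (fun c => rank c)); rewrite !rk => E; rewrite E ltnn in ab.
Qed.

Variable (R : realFieldType) (n : nat).
Implicit Types A B : 'M[R]_n.

(** Sorting an injective [h] multiplies both minors by the same sign, which cancels in the product.
    If [h] takes a value twice, the second minor has two equal rows. *)
Lemma minor_mul_term_ge0 p A B (f g h : 'I_p -> 'I_n) :
  totally_positive A -> totally_positive B ->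
  strictly_incr f -> strictly_incr g ->
  0 <= mx_minor A f h * mx_minor B h g.
Proof.
move=> tA tB sf sg.
have [/injectiveP/injective_sortable[s hs]|] := boolP (injectiveb h).
  have -> : mx_minor A f h = (-1) ^+ s * mx_minor A f (h \o s).
    rewrite /mx_minor (_ : mxsub f (h \o s) A = col_perm s (mxsub f h A)); last first.
      by apply/matrixP => a b; rewrite !mxE.
    by rewrite col_permE det_mulmx det_perm odd_permV mulrCA -expr2 sqrr_sign mulr1.
  have -> : mx_minor B h g = (-1) ^+ s * mx_minor B (h \o s) g.
    rewrite /mx_minor (_ : mxsub (h \o s) g B = row_perm s (mxsub h g B)); last first.
      by apply/matrixP => a b; rewrite !mxE.
    by rewrite row_permE det_mulmx det_perm mulrA -expr2 sqrr_sign mul1r.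
  by rewrite mulrACA -expr2 sqrr_sign mul1r mulr_ge0 ?tA ?tB.
move=> /injectivePn[a [b ab hab]].
rewrite [mx_minor B h g](_ : _ = 0) ?mulr0 //.
by apply: (determinant_alternate ab) => c; rewrite !mxE hab.
Qed.

Lemma minor_mul p A B (f g : 'I_p -> 'I_n) :
  mx_minor (A *m B) f g *+ p`! =
  \sum_(h : {ffun 'I_p -> 'I_n}) mx_minor A f h * mx_minor B h g.
Proof.
rewrite /mx_minor.
have -> : mxsub f g (A *m B) = rowsub f A *m colsub g B.
  by apply/matrixP => a b; rewrite !mxE; apply: eq_bigr => c _; rewrite !mxE.
rewrite -Cauchy_Binet_sym; apply: eq_bigr => h _.
by congr (_ * _); congr (\det _); apply/matrixP => a b; rewrite !mxE.
Qed.

Lemma totally_positive_mul A B :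
  totally_positive A -> totally_positive B -> totally_positive (A *m B).
Proof.
move=> tA tB p f g sf sg.
have : 0 <= mx_minor (A *m B) f g *+ p`!.
  by rewrite minor_mul; apply: sumr_ge0 => h _; exact: minor_mul_term_ge0.
by rewrite pmulrn_lge0 // fact_gt0.
Qed.

(** All terms of the Cauchy-Binet sum are nonnegative, so the single positive term at [h] decides
    the sign. *)
Lemma minor_mul_gt0 p A B (f h g : 'I_p -> 'I_n) :
  totally_positive A -> totally_positive B ->
  strictly_incr f -> strictly_incr g ->
  0 < mx_minor A f h -> 0 < mx_minor B h g -> 0 < mx_minor (A *m B) f g.
Proof.
move=> tA tB sf sg Ah Bh.
have : 0 < mx_minor (A *m B) f g *+ p`!.
  rewrite minor_mul (bigD1 (finfun h)) //= ltr_wpDr //.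
    by apply: sumr_ge0 => k _; exact: minor_mul_term_ge0.
  rewrite /mx_minor (_ : mxsub f _ A = mxsub f h A); last first.
    by apply/matrixP => a b; rewrite !mxE ffunE.
  rewrite (_ : mxsub _ g B = mxsub h g B); last first.
    by apply/matrixP => a b; rewrite !mxE ffunE.
  exact: mulr_gt0.
by rewrite pmulrn_lgt0 // fact_gt0.
Qed.

End CauchyBinet.

(** * Minors of the matrix and of its powers over a real field *)

Section KMSTotallyPositive.
Variables (R : realFieldType) (n : nat).
Implicit Types r : R.

Lemma minor_KMS r p (f g : 'I_p -> 'I_n) : 0 < r <= 1 ->
  mx_minor (KMS n r) f g = (\prod_a r ^+ f a) * (\prod_a r ^+ g a) *
    \det (min_kernel (fun a => (r ^+ (f a).*2)^-1) (fun b => (r ^+ (g b).*2)^-1)).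
Proof.
move=> /andP[r0 r1].
have minE (i j : nat) : r ^+ `|i - j|%N =
    r ^+ i * Num.min (r ^+ i.*2)^-1 (r ^+ j.*2)^-1 * r ^+ j.
  have rn0 : r != 0 by rewrite gt_eqF.
  wlog ij : i j / (i <= j)%N => [wl|].
    case: (leqP i j) => [|/ltnW] ij; first exact: wl.
    by rewrite distnC minC wl //; ring.
  rewrite min_l; last first.
    rewrite lef_pV2 ?posrE ?exprn_gt0 // ler_wiXn2l ?(ltW r0) //; lia.
  rewrite (_ : `|i - j|%N = (j - i)%N); last by lia.
  rewrite -addnn exprD -{2}(subnK ij) exprD.
  by field; rewrite expf_neq0.
have -> : mx_minor (KMS n r) f g = \det (diag_mx (\row_a r ^+ f a) *m
    min_kernel (fun a => (r ^+ (f a).*2)^-1) (fun b => (r ^+ (g b).*2)^-1) *m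
    diag_mx (\row_a r ^+ g a)).
  congr (\det _); apply/matrixP => a b.
  by rewrite mul_diag_mx mul_mx_diag !mxE minE.
rewrite !det_mulmx !det_diag mulrAC.
by congr (_ * _ * _); apply: eq_bigr => a _; rewrite mxE.
Qed.

Lemma strictly_incr_leq p (f : 'I_p -> 'I_n) (a b : 'I_p) :
  strictly_incr f -> (a <= b)%N -> (f a <= f b)%N.
Proof. by move=> sf; rewrite leq_eqVlt => /orP[/eqP/val_inj->//|/sf/ltnW]. Qed.

(** For [r < 1] the nodes [r^(-2i)] increase strictly with [i], so interlacing index sets give
    interlacing nodes. *)
Lemma minor_KMS_gt0 r p (f g : 'I_p -> 'I_n) : 0 < r < 1 ->
  strictly_incr f -> strictly_incr g ->
  (forall a b : 'I_p, (a < b)%N -> (f a < g b)%N /\ (g a < f b)%N) ->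
  0 < mx_minor (KMS n r) f g.
Proof.
move=> /andP[r0 r1] sf sg fg; rewrite minor_KMS ?r0 ?ltW //.
have lt i j : (i < j)%N -> (r ^+ i.*2)^-1 < (r ^+ j.*2)^-1.
  move=> ij; rewrite ltf_pV2 ?posrE ?exprn_gt0 // ltr_iXn2l //; lia.
rewrite !mulr_gt0 //; try by apply: prodr_gt0 => a _; rewrite exprn_gt0.
apply: det_min_kernel_gt0 => [a b ab|a|a]; rewrite ?invr_gt0 ?exprn_gt0 //.
by have [? ?] := fg _ _ ab; split; apply: lt => //; [exact: sf | exact: sg].
Qed.

Lemma minor_scalar1_diag p (f : 'I_p -> 'I_n) :
  strictly_incr f -> mx_minor (1%:M : 'M[R]_n) f f = 1.
Proof.
move=> sf; rewrite /mx_minor (_ : mxsub f f 1%:M = 1%:M) ?det1 //.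
apply/matrixP => a b; rewrite !mxE; case: (eqVneq a b) => [->|ab]; first by rewrite eqxx.
case: eqP => // fab; case: (ltngtP a b) => [/sf|/sf|/val_inj E]; rewrite ?fab ?ltnn //.
by rewrite E eqxx in ab.
Qed.

(** At the first place where two increasing maps differ, the smaller of the two values is missed by
    the other map altogether, so the submatrix of the identity has a zero row or column. *)
Lemma totally_positive_scalar1 : totally_positive (1%:M : 'M[R]_n).
Proof.
move=> p f g sf sg.
have [fg|] := pselect (f = g).
  by rewrite fg minor_scalar1_diag.
move=> fg.
have /existsP : [exists a, f a != g a].
  rewrite -negb_forall; apply/negP => /forallP h; apply: fg; apply/funext => a.
  exact/eqP.
move=> [c0 hc0]; case: (@arg_minnP _ c0 (fun a => f a != g a) val hc0) => a /= fga amin.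
have fgE (b : 'I_p) : (b < a)%N -> f b = g b.
  by move=> ba; apply/eqP; apply: contraTT ba => /amin; rewrite -leqNgt.
rewrite [mx_minor _ f g](_ : _ = 0) //.
case: (ltngtP (f a) (g a)) fga => [lt _|lt _|/val_inj->]; last by rewrite eqxx.
- rewrite /mx_minor (expand_det_row _ a) big1 // => b _; rewrite !mxE.
  case: eqP => [E|]; last by rewrite mul0r.
  have := lt; rewrite E; case: (leqP a b) => [ab|/[dup] ba /fgE gb].
    by move=> h; have := strictly_incr_leq sg ab; rewrite leqNgt h.
  by have := sf _ _ ba; rewrite gb E ltnn.
- rewrite /mx_minor (expand_det_col _ a) big1 // => b _; rewrite !mxE.
  case: eqP => [E|]; last by rewrite mul0r.
  have := lt; rewrite -E; case: (leqP a b) => [ab|/[dup] ba /fgE gb].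
    by move=> h; have := strictly_incr_leq sf ab; rewrite leqNgt h.
  by have := sg _ _ ba; rewrite -gb E ltnn.
Qed.

Lemma KMS0 (C : pzRingType) : KMS n (0 : C) = 1%:M.
Proof.
apply/matrixP => j k; rewrite !mxE expr0n; congr (_ %:R); congr nat_of_bool.
by apply/eqP/eqP => [h|->]; [apply: val_inj => /=; lia | lia].
Qed.

Lemma totally_positive_KMS r : 0 <= r <= 1 -> totally_positive (KMS n r).
Proof.
move=> /andP[]; rewrite le_eqVlt => /predU1P[<- _|r0 r1].
  by rewrite KMS0; exact: totally_positive_scalar1.
move=> p f g sf sg; rewrite minor_KMS ?r0 // !mulr_ge0 //;
  try by apply: prodr_ge0 => a _; rewrite exprn_ge0 // ltW.
have le i j : (i <= j)%N -> (r ^+ i.*2)^-1 <= (r ^+ j.*2)^-1.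
  move=> ij; rewrite lef_pV2 ?posrE ?exprn_gt0 // ler_wiXn2l ?(ltW r0) //; lia.
apply: det_min_kernel_ge0 => [a b ab|a b ab|a|a];
  rewrite ?invr_ge0 ?exprn_ge0 ?(ltW r0) //; exact/le/strictly_incr_leq.
Qed.

(** Written as the iterate in [oscillatory], so that the two unfold to the same term. *)
Definition mxpow (A : 'M[R]_n) m := iter m (mulmx A) 1%:M.

Lemma totally_positive_pow A m : totally_positive A -> totally_positive (mxpow A m).
Proof.
move=> tA; elim: m => [|m IH]; first exact: totally_positive_scalar1.
exact: totally_positive_mul.
Qed.

Lemma mxpowD A m1 m2 : mxpow A (m1 + m2) = mxpow A m1 *m mxpow A m2.
Proof. by elim: m1 => [|m IH]; rewrite ?mul1mx //= -mulmxA -IH. Qed.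

Lemma mxpow_tr A m : (mxpow A m)^T = mxpow A^T m.
Proof.
elim: m => [|m IH]; first by rewrite /= trmx1.
by rewrite -[in LHS]addn1 mxpowD trmx_mul [mxpow A 1]mulmx1 IH.
Qed.

(** The chain [h 0, ..., h m] supplies the intermediate index set for Cauchy-Binet each time a last
    factor is split off. *)
Lemma minor_pow_KMS_gt0 r p (h : nat -> 'I_p -> 'I_n) m : 0 < r < 1 ->
  (forall t, strictly_incr (h t)) ->
  (forall t (a b : 'I_p), (a < b)%N -> (h t a < h t.+1 b)%N /\ (h t.+1 a < h t b)%N) ->
  0 < mx_minor (mxpow (KMS n r) m) (h 0%N) (h m).
Proof.
move=> r01 sh hh.
have tK : totally_positive (KMS n r).
  by apply: totally_positive_KMS; case/andP: r01 => /ltW-> /ltW->.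
elim: m => [|m IH]; first by rewrite minor_scalar1_diag ?ltr01.
rewrite -[X in mxpow _ X]addn1 mxpowD [mxpow _ 1]mulmx1.
apply: (minor_mul_gt0 _ _ (h := h m)) => //; first exact: totally_positive_pow.
exact: (minor_KMS_gt0 r01 (sh m) (sh m.+1) (@hh m)).
Qed.

(* The coordinates are lowered one unit at a time, the a-th one starting only
   at time a, so that consecutive index sets always interlace. *)
Lemma minor_pow_KMS_to_initial_gt0 r m p (f e : 'I_p -> 'I_n) : 0 < r < 1 ->
  strictly_incr f -> (forall a, e a = a :> nat) ->
  (n.*2 <= m)%N -> 0 < mx_minor (mxpow (KMS n r) m) f e.
Proof.
move=> r01 sf eE nm.
have fge (a : 'I_p) : (a <= f a)%N.
  have [k] := ubnP (nat_of_ord a); elim: k a => // k IH a ak.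
  case: (posnP a) => [->//|a0].
  have lt : (a.-1 < p)%N by have := ltn_ord a; lia.
  have /sf : (Ordinal lt < a)%N by rewrite /=; lia.
  have := IH (Ordinal lt); rewrite /=; lia.
(* Truncated subtraction encodes the delay: coordinate [a] stays at [f a] up to time [a], then
   descends to its floor [a]. *)
have hlt t (a : 'I_p) : (maxn a (f a - (t - a)) < n)%N.
  by have := fge a; have := ltn_ord (f a); lia.
pose h t a := Ordinal (hlt t a).
have -> : f = h 0%N by apply/funext => a; apply/val_inj; have /= := fge a; lia.
have -> : e = h m.
  apply/funext => a; apply/val_inj; rewrite /= eE.
  by have := fge a; have := ltn_ord (f a); lia.
have sf' (a b : 'I_p) : (a < b)%N -> (f a + (b - a) <= f b)%N.
  have [k] := ubnP (b - a); elim: k b => // k IH b bk ab.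
  have lt : (b.-1 < p)%N by have := ltn_ord b; lia.
  have /sf : (Ordinal lt < b)%N by rewrite /=; lia.
  have := IH (Ordinal lt); case: (ltngtP a b.-1) => [c|c|c]; rewrite /=; try lia.
  by rewrite (_ : a = Ordinal lt); [rewrite /=; lia | apply/val_inj].
apply: minor_pow_KMS_gt0 => // t a b ab /=; have := sf' _ _ ab; lia.
Qed.

(** Any two index sets of equal size are joined through the initial one: a descent from [f],
    followed by the reverse of a descent from [g]. Each half takes [2n + 1] factors. *)
Lemma oscillatory_KMS r : 0 < r < 1 -> oscillatory (KMS n r).
Proof.
move=> r01.
have tK : totally_positive (KMS n r).
  by apply: totally_positive_KMS; case/andP: r01 => /ltW-> /ltW->.
have s1 : (n.*2 <= n.*2.+1)%N by [].
split=> //; exists (n.*2.+1 + n.*2.+1)%N; split=> // p f g sf sg.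
have pn : (p <= n)%N.
  rewrite -[p]card_ord -[n]card_ord; apply: (leq_card f) => a b fab.
  by case: (ltngtP a b) => [/sf|/sf|/val_inj//]; rewrite fab ltnn.
rewrite -/(mxpow _ _) mxpowD.
apply: (@minor_mul_gt0 _ _ _ _ _ _ (widen_ord pn)) => //;
  try exact: totally_positive_pow.
  exact: minor_pow_KMS_to_initial_gt0.
(* Since the matrix is symmetric, transposing turns the ascent to [g] into a descent from [g]. *)
rewrite /mx_minor -det_tr (_ : _^T = mxsub g (widen_ord pn) (mxpow (KMS n r) n.*2.+1)).
  exact: minor_pow_KMS_to_initial_gt0.
by rewrite -[in RHS]KMS_tr -mxpow_tr; apply/matrixP => a b; rewrite !mxE.
Qed.

End KMSTotallyPositive.

(** * Positive entries, realness, Hermitian symmetry and normality *)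

Lemma normalmx_KMS_real (C : numClosedFieldType) m (rho : C) :
  KMS m.+3 rho \is normalmx -> rho \is Num.real.
Proof.
(* The (0,1) entries of the matrix times its adjoint and of the reverse product agree in the terms
   of index 0 and 1; [S] collects the others, of which there is at least one in size 3 or more. *)
move=> /normalmxP/matrixP/(_ ord0 (lift ord0 ord0)).
pose S (a b : C) := \sum_(k < m.+1) a ^+ k.+2 * b ^+ k.+1.
rewrite (_ : (_ *m _) _ _ = rho^* + rho + S rho rho^*); last first.
  rewrite mxE 2!big_ord_recl !mxE /= expr0 mul1r !expr1 rmorph1 mulr1 addrA.
  congr (_ + _); apply: eq_bigr => k _; rewrite !mxE /= rmorphXn /bump.
  by congr (_ ^+ _ * _ ^+ _); lia.
rewrite (_ : (_ *m _) _ _ = rho^* + rho + S rho^* rho); last first.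
  rewrite mxE 2!big_ord_recl !mxE /= rmorph1 mul1r !expr1 mulr1 addrA [rho + _]addrC.
  congr (_ + _); apply: eq_bigr => k _; rewrite !mxE /= rmorphXn /bump.
  by congr (_ ^+ _ * _ ^+ _); lia.
move=> /addrI/eqP; rewrite -subr_eq0 -sumrB => E.
rewrite CrealE eq_sym -subr_eq0.
(* The difference of the two sums contains the factor [rho] minus its conjugate; the cofactor, a sum
   of powers of [|rho|^2], is positive unless [rho = 0]. *)
have {E} : (rho - rho^*) * (\sum_(k < m.+1) (`|rho| ^+ 2) ^+ k.+1) == 0.
  apply: etrans E; congr (_ == 0); rewrite mulr_sumr; apply: eq_bigr => k _.
  by rewrite normCK exprMn !exprS; ring.
have [-> _|rho0] := eqVneq rho 0; first by rewrite conjC0 subrr.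
rewrite mulf_eq0 => /orP[//|].
rewrite gt_eqF // big_ord_recl ltr_pwDl //.
  by rewrite !exprn_gt0 ?normr_gt0.
by apply: sumr_ge0 => k _; rewrite !exprn_ge0.
Qed.

Section Hermitian.
Variables (C : numClosedFieldType) (n : nat).
Hypothesis hn : (2 <= n)%N.
Variable rho : C.

Let i0 : 'I_n := Ordinal (ltnW hn).
Let i1 : 'I_n := Ordinal hn.

Lemma all_entries_pos_KMS : all_entries_pos (KMS n rho) <-> 0 < rho.
Proof.
split=> [/(_ i0 i1)|rho0 j k]; rewrite mxE ?expr1 //.
exact: exprn_gt0.
Qed.

Lemma symmetricmx_KMS : KMS n rho \is symmetricmx.
Proof. by apply/is_hermitianmxP; rewrite expr0 scale1r map_mx_id // KMS_tr. Qed.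

Lemma realmx_KMS : (KMS n rho \is a mxOver Num.real) = (rho \is Num.real).
Proof.
apply/mxOverP/idP => [/(_ i0 i1)|rhoR j k]; rewrite mxE ?expr1 //.
exact: rpredX.
Qed.

Lemma hermsymmx_KMS : (KMS n rho \is hermsymmx) = (rho \is Num.real).
Proof.
apply/idP/idP => [/is_hermitianmxP/matrixP/(_ i0 i1)|rhoR].
  by rewrite expr0 scale1r !mxE !expr1 => /esym/CrealP.
by rewrite realsym_hermsym ?symmetricmx_KMS ?realmx_KMS.
Qed.

Lemma normalmx_KMS : KMS n rho \is normalmx <-> (rho \is Num.real \/ n = 2%N).
Proof.
split=> [|[rhoR|n2]]; last 2 first.
- by rewrite hermitian_normalmx ?hermsymmx_KMS.
- apply/normalmxP; rewrite n2; apply/matrixP.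
  by move=> [[|[|//]] ?] [[|[|//]] ?]; rewrite !mxE !big_ord_recl !big_ord0 !mxE /=
    ?expr0 ?expr1 ?rmorph1; ring.
have [->|n3] : n = 2%N \/ (2 < n)%N by lia.
  by right.
by rewrite -(subnKC n3) => /normalmx_KMS_real; left.
Qed.

(** With [c = 1] and [c = -1], these test vectors give both bounds on [rho] that positivity of the
    form entails. *)
Lemma KMS_form_pm (c : C) : c \is Num.real -> c * c = 1 ->
  exists2 x : 'cV[C]_n, x != 0 &
    ((x ^t*)%sesqui *m KMS n rho *m x) 0 0 = (1 + c * rho) *+ 2.
Proof.
move=> cR cc; exists (delta_mx i0 0 + c *: delta_mx i1 0).
  apply/eqP => /matrixP/(_ i0 0); rewrite !mxE !eqxx mulr0 addr0.
  by apply/eqP; rewrite oner_eq0.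
have -> : ((delta_mx i0 0 + c *: delta_mx i1 0 : 'cV[C]_n) ^t*)%sesqui =
   delta_mx 0 i0 + c *: delta_mx 0 i1.
  by apply/matrixP => i j; rewrite !mxE rmorphD rmorphM /= !conjC_nat (CrealP cR)
    [_ && (j == i0)]andbC [_ && (j == i1)]andbC.
rewrite !mulmxDl !mulmxDr -!scalemxAl -!scalemxAr -!rowE -!colE !mxE.
by rewrite /= ?expr0 ?expr1; ring: cc.
Qed.

End Hermitian.

(** * The quadratic form as a sum of squares *)

Section QuadraticForm.
Variables (C : numClosedFieldType) (rho : C).
Hypothesis rhoR : rho \is Num.real.
Implicit Types x : nat -> C.

(** Closed form of the first-order autoregressive recursion [s_k = rho s_(k-1) + x_k] started at
    [s_0 = x_0]. *)
Definition ar_state x k := \sum_(j < k.+1) rho ^+ (k - j) * x j.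

Lemma ar_stateS x k : ar_state x k.+1 = rho * ar_state x k + x k.+1.
Proof.
rewrite /ar_state big_ord_recr /= subnn mul1r; congr (_ + _).
rewrite mulr_sumr; apply: eq_bigr => j _.
by rewrite mulrA -exprS subSn // -ltnS.
Qed.

(** Induction on the size. The new row and column add [|x_(m+1)|^2] and the two cross terms of
    [rho s_m] with [x_(m+1)]; splitting [|s_m|^2] into [(1 - rho^2) |s_m|^2 + |rho s_m|^2] completes
    the square to [|s_(m+1)|^2]. *)
Lemma KMS_form_nat x m :
  \sum_(j < m.+1) \sum_(k < m.+1) (x j)^* * rho ^+ `|j - k|%N * x k =
  (1 - rho ^+ 2) * (\sum_(k < m) `|ar_state x k| ^+ 2) + `|ar_state x m| ^+ 2.
Proof.
elim: m => [|m IH].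
  by rewrite !big_ord1 big_ord0 /ar_state big_ord1 normCK /= ?expr0; ring.
have E1 : \sum_(j < m.+1) (x j)^* * rho ^+ `|j - m.+1|%N * x m.+1 =
    (rho * ar_state x m)^* * x m.+1.
  rewrite -mulr_suml; congr (_ * _); rewrite rmorphM rmorph_sum mulr_sumr.
  apply: eq_bigr => j _; rewrite rmorphM rmorphXn /= (CrealP rhoR) mulrA -exprS mulrC.
  by congr (_ ^+ _ * _); have := ltn_ord j; lia.
have E2 : \sum_(k < m.+1) (x m.+1)^* * rho ^+ `|m.+1 - k|%N * x k =
    (x m.+1)^* * (rho * ar_state x m).
  rewrite !mulr_sumr; apply: eq_bigr => j _; rewrite -mulrA; congr (_ * _).
  by rewrite mulrA -exprS; congr (_ ^+ _ * _); have := ltn_ord j; lia.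
rewrite big_ord_recr /= [X in _ + X]big_ord_recr /= distnn expr0 mulr1.
under eq_bigr => j _ do rewrite big_ord_recr /=.
rewrite big_split /= E1 E2 IH big_ord_recr /= ar_stateS !normCK !rmorphD !rmorphM /= (CrealP rhoR).
ring.
Qed.

End QuadraticForm.

(** * Positive definiteness and semidefiniteness *)

Section Definite.
Variables (C : numClosedFieldType) (n : nat).
Hypothesis hn : (2 <= n)%N.
Variable rho : C.

Lemma KMS_form (x : 'cV[C]_n) : rho \is Num.real -> exists2 y : nat -> C,
  (forall i : 'I_n, y i = x i 0) &
  ((x ^t*)%sesqui *m KMS n rho *m x) 0 0 =
  (1 - rho ^+ 2) * (\sum_(k < n.-1) `|ar_state rho y k| ^+ 2) + `|ar_state rho y n.-1| ^+ 2.
Proof.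
(* The vector is extended by zero to a sequence on all of [nat]. *)
move=> rhoR; exists (fun j => if insub j is Some i then x i 0 else 0).
  by move=> i; rewrite valK.
rewrite -KMS_form_nat // prednK ?(ltnW hn) // exchange_big /= !mxE.
apply: eq_bigr => k _; rewrite !mxE mulr_suml; apply: eq_bigr => j _.
by rewrite !mxE !valK.
Qed.

(** In the partial order of [C] only numbers with real difference are comparable, so a comparison
    with 1 already makes [rho] real. *)
Lemma real_of_bounds : (-1 <= rho <= 1) -> rho \is Num.real /\ 0 <= 1 - rho ^+ 2.
Proof.
move=> /andP[h1 h2].
have rhoR : rho \is Num.real by rewrite (ler_real h2) rpred1.
split=> //; rewrite (_ : _ - _ = (1 - rho) * (rho - - 1)); last by ring.
by rewrite mulr_ge0 ?subr_ge0.
Qed.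

Lemma pos_semidef_KMS : pos_semidef (KMS n rho) <-> -1 <= rho <= 1.
Proof.
split=> [psd|/real_of_bounds[rhoR h] x]; last first.
  have [y _ ->] := KMS_form x rhoR.
  by rewrite addr_ge0 ?mulr_ge0 ?sumr_ge0 // => *; rewrite exprn_ge0.
have [x1 _ e1] := KMS_form_pm hn rho (rpred1 _) (mulr1 (1 : C)).
have [||x2 _ e2] := @KMS_form_pm _ _ hn rho (-1).
- by rewrite rpredN rpred1.
- by rewrite mulrNN mulr1.
have := psd x1; have := psd x2; rewrite e1 e2 !pmulrn_lge0 // mul1r mulN1r subr_ge0 => ->.
by rewrite -lerBlDl sub0r => ->.
Qed.

Lemma pos_def_KMS : pos_def (KMS n rho) <-> -1 < rho < 1.
Proof.
split=> [pd|/andP[h1 h2]].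
  have [x1 n1 e1] := KMS_form_pm hn rho (rpred1 _) (mulr1 (1 : C)).
  have [||x2 n2 e2] := @KMS_form_pm _ _ hn rho (-1).
  - by rewrite rpredN rpred1.
  - by rewrite mulrNN mulr1.
  have := pd _ n1; have := pd _ n2; rewrite e1 e2 !pmulrn_lgt0 // mul1r mulN1r subr_gt0 => ->.
  by rewrite -ltrBlDl sub0r => ->.
have [|rhoR h] := real_of_bounds; first by rewrite !ltW.
have {}h : 0 < 1 - rho ^+ 2.
  rewrite (_ : _ - _ = (1 - rho) * (rho - - 1)); last by ring.
  by rewrite mulr_gt0 ?subr_gt0.
move=> x; have [y yx ->] := KMS_form x rhoR => xn0.
have s0 : 0 <= \sum_(k < n.-1) `|ar_state rho y k| ^+ 2.
  by apply: sumr_ge0 => *; rewrite exprn_ge0.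
have h0 := mulr_ge0 (ltW h) s0.
have sn0 : 0 <= `|ar_state rho y n.-1| ^+ 2 by rewrite exprn_ge0.
(* If the form were zero, every square and hence every [s_k] would vanish, and with them every
   [x_k = s_k - rho s_(k-1)]. *)
rewrite lt0r addr_ge0 // andbT; apply: contra xn0; rewrite paddr_eq0 //.
rewrite mulf_eq0 gt_eqF //= psumr_eq0 => [|*]; last by rewrite exprn_ge0.
move=> /andP[/allP s_eq0 sn_eq0].
have {s_eq0 sn_eq0} s_eq0 k : (k < n)%N -> ar_state rho y k = 0.
  move=> kn; apply/eqP; rewrite -normr_eq0 -sqrf_eq0.
  have : (k <= n.-1)%N by lia.
  rewrite leq_eqVlt => /predU1P[->//|kn1].
  by have := s_eq0 (Ordinal kn1); rewrite mem_index_enum => /(_ isT).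
apply/eqP/matrixP => i j; rewrite ord1 -yx mxE.
case: i => -[|k] kn /=.
  by have := s_eq0 0%N kn; rewrite /ar_state big_ord1 mul1r.
by have := s_eq0 k.+1 kn; rewrite ar_stateS s_eq0 ?mulr0 ?add0r // ltnW.
Qed.

End Definite.

(** * Bounds forced by total positivity and oscillation *)

Section Necessity.
Variables (C : numFieldType) (n : nat).
Hypothesis hn : (2 <= n)%N.
Variable rho : C.

Let i0 : 'I_n := Ordinal (ltnW hn).
Let i1 : 'I_n := Ordinal hn.

Lemma minor1 (A : 'M[C]_n) i j : mx_minor A (fun _ : 'I_1 => i) (fun=> j) = A i j.
Proof. by rewrite /mx_minor det_mx11 mxE. Qed.

Lemma strictly_incr1 (i : 'I_n) : strictly_incr (fun _ : 'I_1 => i).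
Proof. by move=> a b; rewrite !ord1. Qed.

(** The entry (0,1) is [rho], and the leading minor of order 2 is [1 - rho^2]. *)
Lemma totally_positive_KMS_bounds : totally_positive (KMS n rho) -> 0 <= rho <= 1.
Proof.
move=> tK.
have rho0 : 0 <= rho.
  by have := tK _ _ _ (@strictly_incr1 i0) (@strictly_incr1 i1); rewrite minor1 mxE expr1.
rewrite rho0 -(@expr_le1 _ 2) //.
have sw : strictly_incr (widen_ord hn) by [].
have := tK _ _ _ sw sw; rewrite /mx_minor (expand_det_row _ ord0) !big_ord_recl big_ord0.
by rewrite /cofactor !det_mx11 !mxE /= !expr0 !expr1; rewrite -subr_ge0; congr (0 <= _); ring.
Qed.

(** At [rho = 0] every power is the identity, with zero entry (0,1). At [rho = 1] all rows coincide,
    so every positive power has determinant 0. *)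
Lemma oscillatory_KMS_bounds : oscillatory (KMS n rho) -> 0 < rho < 1.
Proof.
move=> [/totally_positive_KMS_bounds/andP[rho0 rho1] [m [m0 sK]]].
rewrite !lt_def rho0 rho1 !andbT; apply/andP; split.
  apply/negP => /eqP r0; have := sK _ _ _ (@strictly_incr1 i0) (@strictly_incr1 i1).
  rewrite minor1 r0 KMS0 (_ : iter _ _ _ = 1%:M) ?mxE ?ltxx //.
  by elim: (m) => //= k ->; rewrite mul1mx.
rewrite eq_sym; apply/negP => /eqP r1.
have sid : strictly_incr (@id 'I_n) by [].
have := sK _ _ _ sid sid.
rewrite /mx_minor (_ : mxsub _ _ ?[A] = ?A); last by apply/matrixP => i j; rewrite mxE.
case: m m0 {sK} => // m _; rewrite iterS det_mulmx.
rewrite (determinant_alternate (_ : i0 != i1)) ?mul0r ?ltxx // => k.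
by rewrite !mxE r1 !expr1n.
Qed.

End Necessity.

(** * Passage from real to complex parameters, and Green's matrices *)

Section RealParameter.
Variables (R : realType) (n : nat).
Hypothesis hn : (2 <= n)%N.
Implicit Types rho : R[i].
Local Open Scope complex_scope.

Lemma real_complex_Re rho : rho \is Num.real -> rho = (complex.Re rho)%:C.
Proof. by move=> /RIm_real; case: rho => a b /= [->]. Qed.

Lemma KMS_real_complex (r : R) : KMS n r%:C = map_mx (real_complex R) (KMS n r).
Proof. by apply/matrixP => j k; rewrite !mxE rmorphXn. Qed.

Lemma minor_real_complex p (A : 'M[R]_n) (f g : 'I_p -> 'I_n) :
  mx_minor (map_mx (real_complex R) A) f g = (mx_minor A f g)%:C.
Proof. by rewrite /mx_minor -map_mxsub det_map_mx. Qed.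

(** A nonnegative element of [R[i]] is real, so the matrix is the image of one over [R], where the
    order is total and the min kernel applies. *)
Lemma totally_positive_KMSE rho : totally_positive (KMS n rho) <-> 0 <= rho <= 1.
Proof.
split=> [/(totally_positive_KMS_bounds hn)//|/andP[r0 r1]].
have rhoE := real_complex_Re (ger0_real r0).
move: r0 r1; rewrite rhoE ler0c => r0; rewrite -[1]/(1%:C) lecR => r1.
rewrite KMS_real_complex => p f g sf sg.
by rewrite minor_real_complex ler0c; apply: totally_positive_KMS => //; rewrite r0.
Qed.

Lemma oscillatory_KMSE rho : oscillatory (KMS n rho) <-> 0 < rho < 1.
Proof.
split=> [/(oscillatory_KMS_bounds hn)//|/andP[r0 r1]].
split; first by apply/totally_positive_KMSE; rewrite !ltW.
have rhoE := real_complex_Re (gtr0_real r0).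
move: r0 r1; rewrite rhoE -[1]/(1%:C) -[0]/(0%:C) !ltcR => r0 r1.
have [|_ [m [m0 sK]]] := @oscillatory_KMS R n (complex.Re rho); first by rewrite r0.
exists m; split=> // p f g sf sg.
rewrite KMS_real_complex (_ : iter _ _ _ =
    map_mx (real_complex R) (iter m (mulmx (KMS n (complex.Re rho))) 1%:M)).
  by rewrite minor_real_complex -[0]/(0%:C) ltcR; exact: sK.
by elim: (m) => /= [|k ->]; rewrite ?map_mx1 ?map_mxM.
Qed.

(** If [alpha_0 beta_1 = rho] vanished, so would [alpha_0 beta_0] or [alpha_1 beta_1], which are
    diagonal entries equal to 1. *)
Lemma greens_matrix_KMS rho :
  greens_matrix (KMS n rho) <-> (rho \is Num.real /\ rho != 0).
Proof.
split=> [[al [be [ub _]]]|[rhoR rho0]].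
  pose i0 : 'I_n := Ordinal (ltnW hn).
  pose i1 : 'I_n := Ordinal hn.
  have := ub i0 i1 isT; rewrite mxE expr1 => ->.
  split; first by rewrite realE -[0]/(0%:C) !lecR -realE num_real.
  have := ub i0 i0 isT; have := ub i1 i1 isT; rewrite !mxE /= !expr0.
  move=> [e1] [e0]; apply/eqP => -[] /eqP; rewrite mulf_eq0 => /orP[]/eqP z.
    by move: e0; rewrite z mul0r => /eqP; rewrite oner_eq0.
  by move: e1; rewrite z mulr0 => /eqP; rewrite oner_eq0.
move: rho0; rewrite (real_complex_Re rhoR); move: (complex.Re rho) => r r0.
have {}r0 : r != 0 by apply: contra r0 => /eqP->.
(* For [j <= k] the product of these witnesses is [r^(k-j)]; inverting [r] is where [rho != 0]
   enters. *)
exists (fun j => r ^- j), (fun k => r ^+ k).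
by split=> j k jk; rewrite mxE -rmorphXn /=; congr (_%:C);
  rewrite -{2}(subnK jk) exprD mulrC mulfK ?expf_neq0 //; congr (_ ^+ _); lia.
Qed.

End RealParameter.

(** * Convergence and boundedness of the symbol *)

Section Symbol.
Variable R : realType.
Implicit Types (rho z : R[i]) (t : R).
Local Open Scope complex_scope.
Local Open Scope classical_set_scope.

Lemma cexpiD t u : cexpi (t + u) = cexpi t * cexpi u.
Proof. by rewrite /cexpi cosD sinD; simpc; congr (_ +i* _); ring. Qed.

Lemma cexpi0 : cexpi (0 : R) = 1.
Proof. by rewrite /cexpi cos0 sin0. Qed.

Lemma norm_cexpi t : `|cexpi t| = 1.
Proof. by rewrite normc_def /= cos2Dsin2 sqrtr1. Qed.

Lemma cexpiMn t k : cexpi (t *+ k) = cexpi t ^+ k.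
Proof. by elim: k => [|k IH]; rewrite ?cexpi0 // mulrS cexpiD IH exprS. Qed.

(** The summation index is the frequency shifted by [N], so one more step adds a term at each end,
    of frequency [N + 1] and [-(N + 1)]. *)
Lemma symbol_partialS rho t N : symbol_partial rho t N.+1 =
  symbol_partial rho t N + (rho * cexpi t) ^+ N.+1 + (rho * cexpi (- t)) ^+ N.+1.
Proof.
rewrite /symbol_partial (_ : (2 * N.+1).+1 = (2 * N).+1.+2)%N; last by lia.
rewrite big_nat_recr // big_nat_recl //= [X in X + _]addrC.
rewrite addrAC; congr (_ + _ + _).
- by apply: eq_bigr => i _; congr (_ ^+ _ * cexpi (_%:~R * _)); lia.
- rewrite exprMn -cexpiMn; congr (_ ^+ _ * cexpi _); first by lia.
  rewrite (_ : _ - _ = N.+1%:Z); last by lia.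
  by rewrite -pmulrn mulr_natl.
- rewrite exprMn -cexpiMn; congr (_ ^+ _ * cexpi _); first by rewrite subn0.
  rewrite (_ : Posz 0 - _ = - N.+1%:Z); last by lia.
  by rewrite mulrNz -pmulrn mulNr mulr_natl mulNrn.
Qed.

Lemma symbol_partial0 rho t : symbol_partial rho t 0 = 1.
Proof. by rewrite /symbol_partial big_nat1 subrr mul0r cexpi0 mulr1 expr0. Qed.

(** Positive and negative frequencies form two geometric series; the formula separates their limit
    from a remainder governed by [z^N] and [w^N]. *)
Lemma symbol_partial_geometric rho t N :
  let z := rho * cexpi t in let w := rho * cexpi (- t) in
  z != 1 -> w != 1 -> symbol_partial rho t N =
  (1 + z / (1 - z) + w / (1 - w)) - (z ^+ N * (z / (1 - z)) + w ^+ N * (w / (1 - w))).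
Proof.
move=> z w z1 w1; elim: N => [|N IH]; first by rewrite symbol_partial0 !expr0; ring.
by rewrite symbol_partialS IH -/z -/w !exprS; field; rewrite !subr_eq0 ![1 == _]eq_sym z1 w1.
Qed.

(** Moduli and tolerances in [R[i]] are real, so taking real parts reduces the claim to the real
    geometric sequence of ratio [|z|]. *)
Lemma cvg_exprc z : `|z| < 1 ->
  (fun N => z ^+ N : (R[i] : numFieldType)) @ \oo --> (0 : (R[i] : numFieldType)).
Proof.
move=> z1; apply/cvgr0Pnorm_lt => eps eps0.
have epsE := real_complex_Re (gtr0_real eps0).
have zE := real_complex_Re (normr_real z).
have r1 : `|complex.Re `|z| | < 1 :> R.
  have : 0 <= `|z| < 1 by rewrite z1 normr_ge0.
  by rewrite zE -[0]/(0%:C) -[1]/(1%:C) lecR ltcR => /andP[? ?]; rewrite ger0_norm.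
move: eps0; rewrite epsE -[0]/(0%:C) ltcR => e0.
have /cvgr0Pnorm_lt/(_ _ e0) := cvg_expr r1.
apply: filterS => N h; rewrite normrX zE -rmorphXn ltcR.
exact: le_lt_trans (ler_norm _) h.
Qed.

Lemma symbol_KMS rho : symbol_well_defined_bounded rho <-> `|rho| < 1.
Proof.
split=> [[f [/(_ 0) cf _]]|rho1].
  have d0 : (fun N => symbol_partial rho 0 N.+1 - symbol_partial rho 0 N
      : (R[i] : numFieldType)) @ \oo --> (0 : (R[i] : numFieldType)).
    rewrite -(subrr (f 0)); apply: cvgB => //.
    by rewrite (cvg_shiftS (symbol_partial rho 0 : nat -> (R[i] : numFieldType))).
  (* At angle 0 the increments are [2 rho^(N+1)]; the tolerance 2 cancels their factor and leaves
     [|rho|^(N+1) < 1]. *)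
  have [N _ /(_ N (leqnn N))] := (cvgr0Pnorm_lt _).1 d0 2 (ltr0n _ 2).
  rewrite /= symbol_partialS oppr0 cexpi0 mulr1.
  rewrite (_ : _ - _ = 2 * rho ^+ N.+1); last by ring.
  rewrite normrM normr_nat gtr_pMr // normrX.
  by rewrite expr_lt1.
have zn1 t : rho * cexpi t != 1.
  apply: contraTneq rho1 => /(congr1 Num.norm).
  by rewrite normrM norm_cexpi mulr1 normr1 => ->; rewrite ltxx.
pose g t := let z := rho * cexpi t in z / (1 - z).
have c0 t : (fun N => (rho * cexpi t) ^+ N * g t : (R[i] : numFieldType)) @ \oo
    --> (0 : (R[i] : numFieldType)).
  have zt : `|rho * cexpi t| < 1 by rewrite normrM norm_cexpi mulr1.
  have := cvgMr_tmp (b := g t) (cvg_exprc zt).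
  by rewrite mul0r => h; exact: h.
exists (fun t => 1 + g t + g (- t)); split=> [t|].
  rewrite (_ : symbol_partial rho t = fun N => 1 + g t + g (- t) -
     ((rho * cexpi t) ^+ N * g t + (rho * cexpi (- t)) ^+ N * g (- t))); last first.
    by apply/funext => N; rewrite symbol_partial_geometric.
  rewrite -[X in _ --> X]subr0; apply: cvgB; first exact: cvg_cst.
  rewrite -[X in _ --> X](addr0 0).
  exact: (cvgD (c0 t) (c0 (- t))).
(* This bound is uniform in [t]: the modulus of [rho * cexpi t] is [|rho|], and its distance to 1 is
   at least [1 - |rho|]. *)
pose B : R[i] := `|rho| / (1 - `|rho|).
have gB t : `|g t| <= B.
  rewrite /g /B normrM normfV normrM norm_cexpi mulr1 ler_wpM2l //.
  rewrite lef_pV2 ?posrE ?subr_gt0 // ?normr_gt0 ?subr_eq0 1?eq_sym ?zn1 //.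
  by apply: le_trans (lerB_dist _ _); rewrite normr1 normrM norm_cexpi mulr1.
exists (complex.Re (1 + B + B)) => t.
rewrite -real_complex_Re; last by rewrite ger0_real // !addr_ge0 // divr_ge0 // subr_ge0 ltW.
by rewrite (le_trans (ler_normD _ _)) // lerD // (le_trans (ler_normD _ _)) // normr1 lerD.
Qed.

End Symbol.

Theorem theorem2p3 (R : realType) (n : nat) (hn : (2 <= n)%N) (rho : R[i]) :
  (all_entries_pos (KMS n rho) <-> 0 < rho) /\
      ((KMS n rho \is a realmx /\ KMS n rho \is symmetricmx) <-> rho \is Num.real) /\
      (KMS n rho \is hermsymmx <-> rho \is Num.real) /\
      (symbol_well_defined_bounded rho <-> `|rho| < 1) /\
      ((pos_def (KMS n rho) <-> -1 < rho < 1) /\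
       (pos_semidef (KMS n rho) <-> -1 <= rho <= 1)) /\
      (KMS n rho \is normalmx <-> (rho \is Num.real \/ n = 2%N)) /\
      (greens_matrix (KMS n rho) <-> (rho \is Num.real /\ rho != 0)) /\
      (totally_positive (KMS n rho) <-> 0 <= rho <= 1) /\
      (oscillatory (KMS n rho) <-> 0 < rho < 1).
Proof.
split; first exact: all_entries_pos_KMS.
split; first by rewrite realmx_KMS // symmetricmx_KMS; split=> [[]|].
split; first by rewrite hermsymmx_KMS.
split; first exact: symbol_KMS.
split; first by split; [exact: pos_def_KMS | exact: pos_semidef_KMS].
split; first exact: normalmx_KMS.
split; first exact: greens_matrix_KMS.
split; first exact: totally_positive_KMSE.
exact: oscillatory_KMSE.
Qed.
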